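(* Let $S$ be a numerical semigroup minimally generated by $5$ integers. If $S$ is nearly Gorenstein and not almost symmetric, then its type satisfies $t(S)\le 40$.
   Context: A numerical semigroup is an additive submonoid $S$ of $\mathbb N=\{0,1,2,\dots\}$ with $\mathbb N\setminus S$ finite; it has a unique minimal system of generators, and ''$5$-generated'' means that this system has exactly $5$ elements. Write $M(S)=S\setminus\{0\}$ and let $\operatorname{F}(S)$ be the Frobenius number of $S$ (the largest integer not in $S$). An integer $f\notin S$ is a pseudo-Frobenius number of $S$ if $f+s\in S$ for every $s\in M(S)$; $\operatorname{PF}(S)$ is the set of pseudo-Frobenius numbers and $t(S)=|\operatorname{PF}(S)|$ is the type of $S$. Let $K(S)=\{s\in\mathbb N\mid \operatorname{F}(S)-s\notin S\}$ be the canonical ideal and $S-K(S)=\{x\in\mathbb Z\mid x+K(S)\subseteq S\}$. $S$ is almost symmetric if $K(S)+M(S)\subseteq M(S)$, and nearly Gorenstein if $K(S)+(S-K(S))\supseteq M(S)$. Equivalently, if $n_1,\dots,n_\nu$ are the minimal generators: $S$ is almost symmetric iff $n_i+\operatorname{F}(S)-f\in S$ for all $f\in\operatorname{PF}(S)$ and all $i$; $S$ is nearly Gorenstein iff for every $i$ there is $f_i\in\operatorname{PF}(S)$ with $n_i+f_i-f\in S$ for all $f\in \operatorname{PF}(S)$. *)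

(* Defs.v *)
From mathcomp Require Import all_boot all_order all_algebra finmap.
From mathcomp Require Import mathcomp_extra boolp classical_sets functions.
From mathcomp Require Import cardinality.
From mathcomp Require Import zify.

Set Implicit Arguments.
Unset Strict Implicit.
Unset Printing Implicit Defensive.

Import Order.TTheory GRing.Theory Num.Theory.

Local Open Scope classical_set_scope.
Local Open Scope ring_scope.

Definition submonoid (S : set nat) : Prop :=
  S 0%N /\ forall x y, S x -> S y -> S (x + y)%N.

Definition numerical_semigroup (S : set nat) : Prop :=
  submonoid S /\ finite_set (~` S).

Definition generates (A S : set nat) : Prop := smallest submonoid A = S.

Definition minimal_generators (A S : set nat) : Prop :=
  generates A S /\ forall B : set nat, B `<=` A -> generates B S -> B = A.

Definition n_generated (n : nat) (S : set nat) : Prop :=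
  exists2 A : set nat, minimal_generators A S & (A #= `I_n)%card.

Definition toZ (S : set nat) : set int := [set s%:Z | s in S].

Definition M (S : set nat) : set nat := S `\ 0%N.

Definition is_frobenius (S : set nat) (f : int) : Prop :=
  ~ toZ S f /\ forall g : int, ~ toZ S g -> g <= f.

(* The default value 0 is never used when S is a numerical semigroup:
   see frobeniusP. *)
Definition frobenius (S : set nat) : int := xget 0 (is_frobenius S).

Definition PF (S : set nat) : set int :=
  [set f | ~ toZ S f /\ forall s, M S s -> toZ S (f + s%:Z)].

(* fset_set is the empty set on infinite sets, but PF S is finite when S is a
   numerical semigroup: see finite_PF. *)
Definition semigroup_type (S : set nat) : nat := #|` fset_set (PF S)|%fset.

Definition K (S : set nat) : set nat :=
  [set s | ~ toZ S (frobenius S - s%:Z)].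

Definition S_minus_K (S : set nat) : set int :=
  [set x | forall k, K S k -> toZ S (x + k%:Z)].

Definition almost_symmetric (S : set nat) : Prop :=
  [set (k + m)%N | k in K S & m in M S] `<=` M S.

Definition nearly_gorenstein (S : set nat) : Prop :=
  toZ (M S) `<=` [set k%:Z + x | k in K S & x in S_minus_K S].

Lemma toZE (S : set nat) (n : nat) : toZ S n%:Z = S n.
Proof.
by apply/propext; split=> [[m Sm [<-]] //|Sn]; exists n.
Qed.

Lemma toZ_ge0 (S : set nat) (x : int) : toZ S x -> 0 <= x.
Proof. by case=> m _ <-. Qed.

Lemma numerical_semigroup_bound (S : set nat) : numerical_semigroup S ->
  exists N : nat, forall n, (N <= n)%N -> S n.
Proof.
case=> _ /finite_seqP[s Es]; exists (\max_(i <- s) i).+1 => n Nn.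
apply: contrapT => nS; have : (~` S) n by [].
rewrite Es /= => ns; have := @leq_bigmax_seq _ s xpredT id n ns isT.
by rewrite leqNgt Nn.
Qed.

Lemma frobeniusP (S : set nat) : numerical_semigroup S ->
  is_frobenius S (frobenius S).
Proof.
move=> /numerical_semigroup_bound exN; apply: xgetPex.
have exN' : exists N, `[< forall n, (N <= n)%N -> S n >].
  by case: exN => N HN; exists N; apply/asboolP.
case: (ex_minnP exN') => c /asboolP Hc minc.
exists (c%:Z - 1); split=> [|g nSg].
  case: c Hc minc => [|c] Hc minc; first by move=> /toZ_ge0; lia.
  rewrite (_ : c.+1%:Z - 1 = c%:Z); last by lia.
  rewrite toZE => Sc.
  suff : (c.+1 <= c)%N by lia.
  apply: minc; apply/asboolP => n; rewrite leq_eqVlt => /orP[/eqP <- //|].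
  exact: Hc.
case: (leP g (c%:Z - 1)) => // cg; case: nSg.
have -> : g = `|g|%N%:Z by lia.
rewrite toZE; apply: Hc; lia.
Qed.

Lemma is_frobenius_unique (S : set nat) (f g : int) :
  is_frobenius S f -> is_frobenius S g -> f = g.
Proof.
by move=> [nf maxf] [ng maxg]; apply/eqP; rewrite eq_le maxf // maxg.
Qed.

Lemma finite_PF (S : set nat) : numerical_semigroup S -> finite_set (PF S).
Proof.
move=> nsS; have [nF maxF] := frobeniusP nsS.
set F := frobenius S in nF maxF.
have inS x : F < x -> toZ S x.
  move=> Fx; apply: contrapT => /maxF; lia.
have FN1 : -1 <= F by apply: maxF => /toZ_ge0.
have : PF S `<=` [set n%:Z - 1 | n in `I_((absz (F + 1)%R).+1)].
  move=> f [nf Pf]; have fF := maxF _ nf.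
  suff f1 : -1 <= f by exists (absz (f + 1)) => /=; lia.
  rewrite leNgt; apply/negP => f_lt; apply: nF.
  have pos : 0 < F - f by lia.
  have -> : F = f + (absz (F - f))%:Z by lia.
  apply: Pf; split=> /=; last by lia.
  by rewrite -toZE; apply: inS; lia.
by move/sub_finite_set; apply; exact/finite_image/finite_II.
Qed.

(* Main.v *)
(* Let n_0, ..., n_4 be the minimal generators, F the Frobenius number, phi_x the
   pseudo-Frobenius number attached to n_x by near Gorensteinness, and
   g_x = n_x + phi_x. As S is not almost symmetric, phi is not constantly F; if
   phi_k <> F with n_k minimal, then g_k - F involves a generator n_i with
   phi_i = F, and irreducibility of n_k forces g_i = g_k ("twins").

   Label a pseudo-Frobenius number f by (x, y) when g_x - f, or f + n_x, is a
   multiple of n_y alone. A label determines f, and since rows i and k of the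
   first kind agree there are 4 * 5 + 5 * 4 = 40 of them. If f had no label,
   all the sums g_x - f and f + n_x would involve at least two generators. But
   n_y in g_x - f and n_x in f + n_y are incompatible (their sum would put phi_x
   in S), so counting the 20 ordered pairs makes every support of size exactly
   2, and g_i = g_k determines them all up to symmetry. In that table no x other
   than k can have phi_x <> F with n_x minimal, and phi_m = F is also
   impossible for one of the remaining three indices m. *)
Require Import Defs.
From mathcomp Require Import all_boot all_order all_algebra finmap.
From mathcomp Require Import mathcomp_extra boolp classical_sets functions.
From mathcomp Require Import cardinality zify.

Set Implicit Arguments.
Unset Strict Implicit.
Unset Printing Implicit Defensive.

Import Order.TTheory GRing.Theory Num.Theory.

Local Open Scope ring_scope.

(** * Combinatorics of support tables on five indices *)

Lemma ord5_enum (i k l m : 'I_5) : uniq [:: i; k; l; m] ->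
  exists p, perm_eq (index_enum 'I_5) [:: i; k; l; m; p].
Proof.
move=> u4; have [p p4] : exists p, p \notin [:: i; k; l; m].
  apply/existsP; apply: contraT; rewrite negb_exists => /forallP all4.
  have /subset_leq_card : 'I_5 \subset [:: i; k; l; m].
    by apply/fintype.subsetP => x _; have := all4 x; rewrite negbK.
  by rewrite card_ord (card_uniqP u4).
have u5 : uniq (rcons [:: i; k; l; m] p) by rewrite rcons_uniq p4.
exists p; apply: uniq_perm; rewrite ?index_enum_uniq // => x.
rewrite mem_index_enum; apply/esym; apply: contraT => xnot.
have /card_uniqP u6 : uniq (x :: rcons [:: i; k; l; m] p).
  by rewrite cons_uniq xnot.
by have := max_card [in x :: rcons [:: i; k; l; m] p]; rewrite card_ord u6.
Qed.

Lemma sum_ge2 (T : finType) (a : pred T) y z : y != z -> a y -> a z ->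
  (2 <= \sum_x a x)%N.
Proof.
move=> yz ay az; rewrite (bigD1 y) //= (bigD1 z) ?ay ?az //=.
by rewrite eq_sym.
Qed.

(* Row x of b avoids x and the entries of column x of a. *)
Lemma column_le2 (a b : rel 'I_5) x : (forall y, ~~ (a y x && b x y)) ->
  ~~ a x x -> ~~ b x x -> (2 <= \sum_y b x y)%N -> (\sum_y a y x <= 2)%N.
Proof.
move=> ab axx bxx b2; rewrite -(leq_add2r 2).
apply: (@leq_trans (\sum_y (a y x + b x y))%N).
  by rewrite big_split leq_add2l.
rewrite (bigD1 x) //= (negbTE axx) (negbTE bxx) add0n.
apply: (@leq_trans (\sum_(y | y != x) 1)%N); last first.
  by rewrite sum1_card cardC1 card_ord.
by apply: leq_sum => y _; have := ab y; case: (a y x); case: (b x y).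
Qed.

(* The rows of a and b are the supports of g_x - f and f + n_x. Up to swapping l
   and m, the supports are forced: a_i = a_k = {l, m}, a_l = {p, i},
   a_m = {p, k}, a_p = {i, k}, and b y x = ~~ a x y off the diagonal. *)
Lemma twin_support_table (a b : rel 'I_5) (i k : 'I_5) : i != k ->
  (forall x, ~~ a x x) -> (forall x, ~~ b x x) ->
  (forall x y, ~~ (a x y && b y x)) ->
  (forall x, (2 <= \sum_y a x y)%N) -> (forall x, (2 <= \sum_y b x y)%N) ->
  a i =1 a k ->
  exists l m p, [/\ perm_eq (index_enum 'I_5) [:: i; k; l; m; p],
    forall y, b i y -> y \in [:: k; m], forall y, b k y -> y \in [:: i; l]
    & [&& ~~ b p l, ~~ b m k, a m k & [&& a l i, a p i, a l p & ~~ a m i]]].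
Proof.
move=> ik axx bxx ab a2 b2 aik.
have aik0 : ~~ a i k by rewrite aik axx.
have aki0 : ~~ a k i by rewrite -aik axx.
have [l ail] : exists l, a i l.
  apply/existsP; apply: contraT; rewrite negb_exists => /forallP ai0.
  have := a2 i; rewrite big1 // => y _.
  by rewrite (negbTE (ai0 y)).
have [m lm aim] : exists2 m, l != m & a i m.
  apply/exists_inP; apply: contraT; rewrite negb_exists_in => /forall_inP ai0.
  have := a2 i; rewrite (bigD1 l) //= big1 ?ail // => y yl.
  by rewrite (negbTE (ai0 y _)) // eq_sym.
have il : i != l by apply: contraTneq ail => <-.
have im : i != m by apply: contraTneq aim => <-.
have kl : k != l by apply: contraTneq ail => <-.
have km : k != m by apply: contraTneq aim => <-.
have [p eqp] : exists p, perm_eq (index_enum 'I_5) [:: i; k; l; m; p].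
  by apply: ord5_enum; rewrite /= !inE !negb_or ik il im kl km lm.
have akl : a k l by rewrite -aik.
have akm : a k m by rewrite -aik.
have aipk := aik p.
have sumE (c : rel 'I_5) x :
    (\sum_y c x y = c x i + (c x k + (c x l + (c x m + c x p))))%N.
  by rewrite (perm_big _ eqp) /= !big_cons big_nil addn0.
have inE5 x : x \in [:: i; k; l; m; p] by rewrite -(perm_mem eqp) mem_index_enum.
have col x : (a i x + (a k x + (a l x + (a m x + a p x))) <= 2)%N.
  rewrite -(sumE (fun x y => a y x)).
  by apply: (column_le2 (b := b)) => //; exact: b2.
have row x : (2 <= a x i + (a x k + (a x l + (a x m + a x p))))%N.
  by rewrite -sumE.
have notb x y : a x y -> b y x = false.
  by move=> axy; have := ab x y; rewrite axy => /negbTE.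
(* Rows [i] and [k] already fill column [l], whose bound is 2; the same happens in column [m]. *)
have /andP[aml apl] : ~~ a m l && ~~ a p l.
  by move: (col l); rewrite ail akl; case: (a m l); case: (a p l); case: (a l l).
have /andP[alm apm] : ~~ a l m && ~~ a p m.
  by move: (col m); rewrite aim akm; case: (a l m); case: (a p m); case: (a m m).
have /andP[api apk] : a p i && a p k.
  move: (row p); rewrite (negbTE apl) (negbTE apm) (negbTE (axx p)).
  by case: (a p i); case: (a p k).
(* Rows [l] and [m] need four entries in all, while columns [i] and [k] have room for one more each.
   So both rows meet [p] and share out [i] and [k]; the two ways differ by swapping [l] and [m]. *)
have /orP[/and4P[alp ali amk nami]|/and4P[amp ami alk nali]] :
    [&& a l p, a l i, a m k & ~~ a m i] ||
    [&& a m p, a m i, a l k & ~~ a l i].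
  move: (col i) (col k) (col p) (row l) (row m).
  rewrite api apk (negbTE aml) (negbTE alm) !(negbTE (axx _)).
  rewrite (negbTE aik0) (negbTE aki0) -aipk.
  case: (a i p); case: (a l p); case: (a m p) => //;
  case: (a l i); case: (a l k) => //; case: (a m i); case: (a m k) => //.
- exists l, m, p; split=> // [y|y|]; last by rewrite !notb // amk ali api alp.
  + by have := inE5 y; rewrite !inE => /or4P[|||/orP[]] /eqP->;
      rewrite ?eqxx ?orbT // ?(negbTE (bxx _)) // notb.
  + by have := inE5 y; rewrite !inE => /or4P[|||/orP[]] /eqP->;
      rewrite ?eqxx ?orbT // ?(negbTE (bxx _)) // notb.
- exists m, l, p; split=> [|y|y|]; last by rewrite !notb // alk ami api amp.
  + apply: (perm_trans eqp); rewrite !perm_cons.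
    by rewrite -!(cat1s _ [:: _; p]) -!(cat1s _ [:: p]) perm_catCA.
  + by have := inE5 y; rewrite !inE => /or4P[|||/orP[]] /eqP->;
      rewrite ?eqxx ?orbT // ?(negbTE (bxx _)) // notb.
  + by have := inE5 y; rewrite !inE => /or4P[|||/orP[]] /eqP->;
      rewrite ?eqxx ?orbT // ?(negbTE (bxx _)) // notb.
Qed.

(** * Generators and near Gorensteinness over the integers *)

(** Generation is stated as peeling off one generator, the form used in inductions, and minimality
    as irreducibility. *)
Record minimal_system (S : set nat) (I : Type) (n : I -> int) : Prop :=
  MinimalSystem {
    system_mem : forall x, toZ S (n x);
    system_gt0 : forall x, 0 < n x;
    system_gen : forall v, toZ S v ->
      v = 0 \/ exists x w, toZ S w /\ v = n x + w;
    system_irr : forall x a b, toZ S a -> toZ S b -> n x = a + b ->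
      a = 0 \/ b = 0 }.

Definition ng_vector (S : set nat) (I : Type) (n phi : I -> int) : Prop :=
  (forall x, PF S (phi x)) /\
  forall x f, PF S f -> toZ S (n x + phi x - f).

(** * Gaps and pseudo-Frobenius numbers *)

Section NumericalSemigroup.
Variable S : set nat.
Hypothesis HS : numerical_semigroup S.

Lemma toZ0 : toZ S 0.
Proof. by exists 0%N => //; case: HS => -[]. Qed.

Lemma toZD x y : toZ S x -> toZ S y -> toZ S (x + y).
Proof.
case=> a Sa <- [b Sb <-]; exists (a + b)%N => //.
by case: HS => -[_ SD] _; apply: SD.
Qed.

Lemma toZMn x c : toZ S x -> toZ S (x *+ c).
Proof.
move=> Sx; elim: c => [|c IHc]; first by rewrite mulr0n; exact: toZ0.
by rewrite mulrS; apply: toZD.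
Qed.

Lemma le_frobenius z : ~ toZ S z -> z <= frobenius S.
Proof. by case: (frobeniusP HS) => _; apply. Qed.

Lemma toZ_gt_frobenius z : frobenius S < z -> toZ S z.
Proof. by move=> Fz; apply: contrapT => /le_frobenius; lia. Qed.

Lemma PF_toZD f w : PF S f -> toZ S w -> w <> 0 -> toZ S (f + w).
Proof.
by case=> _ Pf [s Ss <-] s0; apply: Pf; split => //= s0'; apply: s0; rewrite s0'.
Qed.

Lemma PF_inj f h w : PF S f -> ~ toZ S h -> toZ S w -> h = f + w -> w = 0.
Proof.
move=> Pf nh Sw hE; apply: contrapT => w0; apply: nh.
by rewrite hE; apply: PF_toZD.
Qed.

Lemma PF_frobenius : PF S (frobenius S).
Proof.
case: (frobeniusP HS) => nF _; split=> // s [_ /= s0].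
by apply: toZ_gt_frobenius; lia.
Qed.

(** A gap that is not pseudo-Frobenius has a larger gap [z + s] with [s] in [S]; the climb stops
    because gaps are bounded by the Frobenius number. *)
Lemma PF_above z : ~ toZ S z -> exists2 f, PF S f & toZ S (f - z).
Proof.
have [d] := ubnP `|frobenius S - z|%N; elim: d z => // d IHd z ltd nz.
have zF := le_frobenius nz.
have [Pz|nPz] := pselect (PF S z).
  by exists z => //; rewrite subrr; exact: toZ0.
have [s [Ss s0] nzs] : exists2 s, M S s & ~ toZ S (z + s%:Z).
  by apply: contrapT => nex; apply: nPz; split => // s Ms; apply: contrapT => nzs;
     apply: nex; exists s.
have s_gt0 : (0 < s)%N by move/eqP: s0; lia.
have zsF := le_frobenius nzs.
have [|f Pf Sf] := IHd _ _ nzs; first by lia.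
exists f => //; rewrite (_ : f - z = f - (z + s%:Z) + s%:Z); last by lia.
by apply: toZD => //; exists s.
Qed.

(** Induction on [v]: peel off one generator and compare it with the decomposition of the rest. The
    index [x0] writes [v = 0] as a zero multiple. *)
Lemma two_generators (I : eqType) (n : I -> int) (Hn : minimal_system S n)
    (x0 : I) v : toZ S v ->
  (exists y c, v = n y *+ c) \/
  exists y z w, [/\ y != z, toZ S w & v = n y + n z + w].
Proof.
have [d] := ubnP `|v|%N; elim: d v => // d IHd v ltd Sv.
have [->|[x [w [Sw vE]]]] := system_gen Hn Sv.
  by left; exists x0, 0%N; rewrite mulr0n.
have nx := system_gt0 Hn x; have w_ge0 := toZ_ge0 Sw.
have [|||] := IHd w; [by lia|by []|move=> [y [c wE]]|].
- have [xy|xy] := eqVneq x y.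
    by left; exists x, c.+1; rewrite mulrS vE wE xy.
  case: c wE => [|c] wE; first by left; exists x, 1%N; rewrite vE wE; lia.
  right; exists x, y, (n y *+ c); split=> //; first by apply/toZMn/(system_mem Hn).
  by rewrite vE wE mulrS; lia.
- move=> [y [z [w' [yz Sw' wE]]]]; right; exists y, z, (w' + n x).
  by split=> //; [apply: toZD => //; apply: (system_mem Hn)|lia].
Qed.

(** * Existence of twins *)

Section NearlyGorensteinVector.
Variables (I : eqType) (n phi : I -> int).
Hypothesis Hn : minimal_system S n.
Hypothesis Hphi : ng_vector S n phi.

Let PF_phi x : PF S (phi x). Proof. by case: Hphi. Qed.
Let ng_phi x f : PF S f -> toZ S (n x + phi x - f).
Proof. by case: Hphi => _; apply. Qed.

Local Notation F := (frobenius S).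
Local Notation g x := (n x + phi x).

(** The hypotheses give [n k = (g l - phi k) + v] with both terms in [S]. The first is
    [n l + (F - phi k) > 0], so irreducibility yields [v = 0]. *)
Lemma gen_sub_frobenius l k v : phi l = F -> toZ S v ->
  g k - F = n l + v -> g l = g k.
Proof.
move=> lF Sv kE.
have kF : phi k <= F by apply: le_frobenius; case: (PF_phi k).
have nl := system_gt0 Hn l.
have Su := ng_phi l (PF_phi k).
have [|u0|v0] := system_irr Hn (x := k) Su Sv; by lia.
Qed.

Lemma frobenius_sub_gen x : phi x <> F ->
  exists y v, toZ S v /\ g x - F = n y + v.
Proof.
move=> xF; have Sgx := ng_phi x PF_frobenius.
have [v0|//] := system_gen Hn Sgx.
case: PF_frobenius => nF _; case: nF.
rewrite (_ : F = phi x + n x); last by lia.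
apply: PF_toZD => //; first exact: (system_mem Hn).
by have := system_gt0 Hn x; lia.
Qed.

Lemma frobenius_sub_lt x y v : phi x <> F -> toZ S v -> g x - F = n y + v ->
  y != x /\ n y < n x.
Proof.
move=> xF Sv vE.
have lexF : phi x <= F by apply: le_frobenius; case: (PF_phi x).
have v_ge0 := toZ_ge0 Sv.
split; last by lia.
by apply/eqP => yx; move: vE; rewrite yx; lia.
Qed.

(** Descent on [n x]: a generator [n y] occurring in [g x - F] is smaller than [n x]. Either
    [phi y = F] and [y], [x] are twins, or [y] replaces [x]. *)
Lemma exists_twin x : phi x <> F ->
  exists i k, [/\ phi i = F, phi k <> F & g i = g k].
Proof.
have [d] := ubnP `|n x|%N; elim: d x => // d IHd x ltd xF.
have [y [v [Sv vE]]] := frobenius_sub_gen xF.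
have [yx ltyx] := frobenius_sub_lt xF Sv vE.
have [yF|yF] := eqVneq (phi y) F.
  by exists y, x; split => //; apply: gen_sub_frobenius vE.
by apply: (IHd y); [have := system_gt0 Hn y; lia|exact/eqP].
Qed.

End NearlyGorensteinVector.

(** * Excluding unlabelled pseudo-Frobenius numbers *)

Section FiveGenerators.
Variables (n phi : 'I_5 -> int).
Hypothesis Hn : minimal_system S n.
Hypothesis Hphi : ng_vector S n phi.

Local Notation F := (frobenius S).
Local Notation g x := (n x + phi x).

Let PF_phi x : PF S (phi x). Proof. by case: Hphi. Qed.
Let ng_phi x f : PF S f -> toZ S (n x + phi x - f).
Proof. by case: Hphi => _; apply. Qed.

Definition summand (v : int) (y : 'I_5) : bool :=
  `[< exists2 w, toZ S w & v = n y + w >].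

Lemma summandP v y : reflect (exists2 w, toZ S w & v = n y + w) (summand v y).
Proof. exact: asboolP. Qed.

Lemma two_summands v : toZ S v -> (forall y c, v <> n y *+ c) ->
  exists y z, [/\ y != z, summand v y, summand v z &
    exists2 w, toZ S w & v = n y + n z + w].
Proof.
move=> Sv nv; have [[y [c /nv//]]|[y [z [w [yz Sw vE]]]]] :=
  two_generators Hn ord0 Sv.
have [Sy Sz] := (system_mem Hn y, system_mem Hn z).
exists y, z; split=> //; [| |by exists w]; apply/summandP.
  by exists (n z + w); [apply: toZD|rewrite vE addrA].
by exists (n y + w); [apply: toZD|rewrite vE; lia].
Qed.

Definition unlabelled (f : int) : Prop :=
  [/\ PF S f, forall x y c, g x - f <> n y *+ c &
    forall x y c, x != y -> f + n x <> n y *+ c].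

Section Unlabelled.
Variable f : int.
Hypothesis Hf : unlabelled f.

Local Notation a := (fun x y => summand (g x - f) y).
Local Notation b := (fun x y => summand (f + n x) y).

Let PF_f : PF S f. Proof. by case: Hf. Qed.
Let nSf : ~ toZ S f. Proof. by case: PF_f. Qed.

Lemma unlabelled_phi x : f <> phi x.
Proof.
case: Hf => _ nA _ fx; apply: (nA x x 1%N).
by rewrite fx addrK.
Qed.

Lemma unlabelled_A x : exists y z, [/\ y != z, a x y, a x z &
  exists2 w, toZ S w & g x - f = n y + n z + w].
Proof. by apply: two_summands; [exact: ng_phi|case: Hf => _ nA _; exact: nA]. Qed.

Lemma unlabelled_B x : exists y z, [/\ y != z, b x y, b x z &
  exists2 w, toZ S w & f + n x = n y + n z + w].
Proof.
have nx := system_gt0 Hn x.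
apply: two_summands.
  by apply: PF_toZD => //; [exact: (system_mem Hn)|lia].
move=> y c E; case: (Hf) => _ _ nB; have [xy|/nB/(_ E)//] := eqVneq x y.
(* Multiples of [n x] itself: zero is also a multiple of another generator, and a positive multiple
   would put [f] in [S]. *)
case: c E => [|c] E.
  by case: (nB x (lift x ord0) 0%N (neq_lift _ _)).
apply: nSf; rewrite (_ : f = n y *+ c); last by rewrite xy mulrS in E; lia.
by apply: toZMn; exact: (system_mem Hn).
Qed.

(** Removing [n x] would leave [phi x - f] in [S], forcing [f = phi x]. *)
Lemma unlabelled_axx x : ~~ a x x.
Proof.
apply/negP => /summandP[w Sw E]; apply: (@unlabelled_phi x).
have phiE : phi x = f + w by lia.
have nphi : ~ toZ S (phi x) by case: (PF_phi x).
by rewrite phiE (PF_inj PF_f nphi Sw phiE) addr0.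
Qed.

Lemma unlabelled_bxx x : ~~ b x x.
Proof.
by apply/negP => /summandP[w Sw E]; apply: nSf; rewrite (_ : f = w) //; lia.
Qed.

Lemma unlabelled_ab x y : ~~ (a x y && b y x).
Proof.
apply/negP => /andP[/summandP[w Sw E] /summandP[w' Sw' E']].
case: (PF_phi x) => nx _; apply: nx.
by rewrite (_ : phi x = w + w'); [apply: toZD|lia].
Qed.

(** A support contained in two indices and containing two distinct ones is known exactly, so the
    bounds on rows [i] and [k] of [b] become equations for [f + n i] and [f + n k]. *)
Lemma unlabelled_table i k : phi i <> phi k -> g i = g k ->
  exists l m p, [/\ forall x, x \in [:: i; k; l; m; p],
    exists2 w, toZ S w & f + n i = n k + n m + w,
    exists2 w, toZ S w & f + n k = n i + n l + w &
    [&& ~~ b p l, ~~ b m k, a m k & [&& a l i, a p i, a l p & ~~ a m i]]].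
Proof.
move=> ik gik; have ik' : i != k by apply: contra_notN ik => /eqP->.
have [||y|l [m [p [eqp bi bk tab]]]] :=
    twin_support_table (b := b) ik' unlabelled_axx unlabelled_bxx unlabelled_ab.
- by move=> x; have [y [z [yz ay az _]]] := unlabelled_A x; apply: sum_ge2 yz ay az.
- by move=> x; have [y [z [yz ay az _]]] := unlabelled_B x; apply: sum_ge2 yz ay az.
- by rewrite /= gik.
exists l, m, p; split => //.
- by move=> x; rewrite -(perm_mem eqp) mem_index_enum.
- have [y [z [yz /bi yb /bi zb [w Sw E]]]] := unlabelled_B i; exists w => //.
  move: yb zb yz; rewrite E !inE => /orP[]/eqP-> /orP[]/eqP->;
    by rewrite ?eqxx // [n m + _]addrC.
- have [y [z [yz /bk yb /bk zb [w Sw E]]]] := unlabelled_B k; exists w => //.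
  move: yb zb yz; rewrite E !inE => /orP[]/eqP-> /orP[]/eqP->;
    by rewrite ?eqxx // [n l + _]addrC.
Qed.

Lemma no_unlabelled_of_twins i k : phi i = F -> phi k <> F -> g i = g k -> False.
Proof.
move=> iF kF gik.
have ik : phi i <> phi k by rewrite iF => Fk; apply: kF.
have [l [m [p [inE5 [w Sw Ei] [w' Sw' Ek] /and4P[npl nmk amk tab]]]]] :=
  unlabelled_table ik gik.
have [ali api alp ami] := and4P tab.
have axx := unlabelled_axx.
have mF : phi m <> F.
  move=> mF; have Smk := ng_phi m (PF_phi k).
  (* Twinness reads [n k - n i = F - phi k]; insert this into [Ei]. *)
  have fE : f = w + (g m - phi k) by clear -Ei mF iF gik; lia.
  by apply: nSf; rewrite fE; apply: toZD.
have mk : m != k.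
  by apply: contraTneq amk => mk; rewrite mk; exact: axx.
(* Minimality of [n x] blocks the descent: a generator occurring in [g x - F] is [n k] or has [phi]
   equal to [F]. *)
have [x /andP[/eqP xF xk] xmin] :=
  @arg_minnP _ m (fun x => (phi x != F) && (x != k)) (fun x => `|n x|%N)
    (introT andP (conj (introN eqP mF) mk)).
have xlmp : [|| x == l, x == m | x == p].
  have := inE5 x; rewrite !inE (negbTE xk).
  by have -> : (x == i) = false by apply: contra_notF xF => /eqP->.
have only_k y v : toZ S v -> g x - F = n y + v -> y = k.
  move=> Sv vE; have [yx ltyx] := frobenius_sub_lt Hphi xF Sv vE.
  have [yF|yF] := eqVneq (phi y) F; last first.
    apply/eqP; apply: contraT => yk; have := xmin y; rewrite yF yk => /(_ isT).
    have := system_gt0 Hn y; clear -ltyx; lia.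
  (* Now [y] and [x] would be twins with equal rows in [a]; the table or [y != x] refutes each
     case. *)
  have gyx := gen_sub_frobenius Hn Hphi yF Sv vE.
  have ayx z : a y z = a x z by rewrite /= gyx.
  have := inE5 y; rewrite !inE.
  have -> : (y == k) = false by apply: contra_notF kF => /eqP<-.
  have -> : (y == m) = false by apply: contra_notF mF => /eqP<-.
  have [[ayi ayk] ayp] := (ayx i, ayx k, ayx p).
  have aik : a i k = false by apply/negbTE; rewrite /= gik; exact: axx.
  rewrite /= => /or3P[] /eqP yE; case/or3P: xlmp => /eqP xE;
    rewrite yE xE in yx ayi ayk ayp.
  - by move: ayi; rewrite /= (negbTE (axx i)) ali.
  - by move: ayk; rewrite /= aik amk.
  - by move: ayi; rewrite /= (negbTE (axx i)) api.
  - by rewrite eqxx in yx.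
  - by move: ayi; rewrite /= ali (negbTE ami).
  - by move: ayp; rewrite /= alp (negbTE (axx p)).
  - by move: ayp; rewrite /= alp (negbTE (axx p)).
  - by move: ayi; rewrite /= api (negbTE ami).
  - by rewrite eqxx in yx.
have FnF : ~ toZ S F by case: PF_frobenius.
have [y0 [v [Sv vE]]] := frobenius_sub_gen Hn Hphi xF.
have y0k := only_k _ _ Sv vE; rewrite {}y0k in vE.
have Su := ng_phi i (PF_phi x).
(* Combining [vE] with [Ek] exhibits [n l] as a summand of [f + n x]. This is absurd for [x = l],
   and for [x = p] by [npl]. *)
have fxE : f + n x = n l + (w' + v + (g i - phi x)) by clear -vE Ek iF; lia.
have Swvu : toZ S (w' + v + (g i - phi x)) by apply: toZD => //; apply: toZD.
case/or3P: xlmp => /eqP xE; rewrite xE in vE Su fxE Swvu only_k.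
- by apply: nSf; rewrite (_ : f = w' + v + (g i - phi l)) //; clear -fxE; lia.
(* Case [x = m]. If [v = 0], then [F - f] lies in [S], so [f = F = phi i]. Otherwise [only_k] gives
   a second copy of [n k] in [g m - F], which ends up in [f + n m] against [nmk]. *)
- have [v0|[y [v' [Sv' v'E]]]] := system_gen Hn Sv.
    have /summandP[w2 Sw2 w2E] := amk; apply: (@unlabelled_phi i).
    have FE : F = f + w2 by clear -vE w2E v0; lia.
    by rewrite iF FE (PF_inj PF_f FnF Sw2 FE) addr0.
  have yk : y = k.
    apply: (only_k y (n k + v')); last by clear -vE v'E; lia.
    by apply: toZD => //; apply: (system_mem Hn).
  move/negP: nmk; apply; apply/summandP.
  exists (n l + (w' + v' + (g i - phi m))).
    apply: toZD; first exact: (system_mem Hn).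
    by apply: toZD => //; apply: toZD.
  by clear -fxE yk v'E; rewrite yk in v'E; lia.
- by move/negP: npl; apply; apply/summandP; exists (w' + v + (g i - phi p)).
Qed.

End Unlabelled.

(** * Counting labels *)

(** The two numbers differ by a multiple of [n y], which lies in [S] and must therefore vanish. *)
Lemma PF_mod_generator f f' y c c' : PF S f -> PF S f' ->
  f + n y *+ c = f' + n y *+ c' -> f = f'.
Proof.
wlog le_c : f f' c c' / (c <= c')%N => [wl Pf Pf' E|Pf Pf' E].
  by have [/wl|/ltnW/wl wl'] := leqP c c'; [exact|apply/esym/wl'].
have nf : ~ toZ S f by case: Pf.
have fE : f = f' + n y *+ (c' - c) by rewrite mulrnBr //; lia.
have Sw : toZ S (n y *+ (c' - c)) by apply/toZMn/(system_mem Hn).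
by rewrite fE (PF_inj Pf' nf Sw fE) addr0.
Qed.

Lemma type_le40_of_twins i k : phi i = F -> phi k <> F -> g i = g k ->
  (semigroup_type S <= 40)%N.
Proof.
move=> iF kF gik.
pose label := ('I_4 * 'I_5 + 'I_5 * 'I_4)%type.
pose has_label (f : int) (t : label) := match t with
  | inl (j, y) => exists c, g (lift k j) - f = n y *+ c
  | inr (x, j) => exists c, f + n x = n (lift x j) *+ c
  end.
have label_inj t f f' : PF S f -> PF S f' -> has_label f t -> has_label f' t ->
    f = f'.
  case: t => -[x y] /= Pf Pf' [c E] [c' E'].
    by apply: (PF_mod_generator (y := y) (c := c) (c' := c')) => //; rewrite -E -E'; lia.
  by apply: (PF_mod_generator (y := lift x y) (c := c') (c' := c)) => //;
     rewrite -E -E'; lia.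
have ex_label f : PF S f -> exists t, has_label f t.
  move=> Pf; apply: contrapT => nt.
  have nA x y c : x != k -> g x - f <> n y *+ c.
    move=> xk E; case: (unliftP k x) xk E => [j ->|->]; last by rewrite eqxx.
    by move=> _ E; apply: nt; exists (inl (j, y)), c.
  apply: (@no_unlabelled_of_twins f _ i k) => //; split=> // x y c.
    (* Row [k] is read off row [i], and [i != k] since only [phi i] is [F]. *)
    have [->|xk] := eqVneq x k; last exact: nA.
    by rewrite -gik; apply: nA; apply: contra_notN kF => /eqP<-.
  move=> xy E; case: (unliftP x y) xy E => [j ->|->]; last by rewrite eqxx.
  by move=> _ E; apply: nt; exists (inr (x, j)), c.
have [h hP] : exists h : int -> label, forall f, PF S f -> has_label f (h f).
  (* The default is returned only where no label exists, hence never on [PF S]. *)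
  exists (fun f => xget (inl (ord0, ord0)) (has_label f)) => f /ex_label.
  exact: xgetPex.
rewrite /semigroup_type; set s := fset_set _.
have sP f : f \in s -> PF S f.
  by rewrite in_fset_set ?inE //; apply: finite_PF.
have /uniq_leq_size : uniq (map h s).
  rewrite map_inj_in_uniq ?fset_uniq // => f f' /sP Pf /sP Pf' E.
  by apply: (label_inj (h f)) => //; [exact: hP|rewrite E; exact: hP].
move=> /(_ (enum {: label})); rewrite size_map -cardE card_sum !card_prod !card_ord.
by apply=> t _; rewrite mem_enum.
Qed.

End FiveGenerators.

(** * Translating the ideal-theoretic definitions *)

(** Write [n x = k + z] with [k] in [K S] and [z] in [S_minus_K S]; then [frobenius S - k] serves as
    [phi x]. *)
Lemma exists_ng_vector (I : Type) (n : I -> int) : minimal_system S n ->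
  nearly_gorenstein S -> ~ almost_symmetric S -> exists phi, ng_vector S n phi.
Proof.
move=> Hn Hng Hnas.
suff /choice[phi phiP] : forall x, exists h, PF S h /\
    forall f, PF S f -> toZ S (n x + h - f).
  by exists phi; split=> x; case: (phiP x).
move=> x; have [nF _] := PF_frobenius.
have [m Sm mx] := system_mem Hn x.
have [k Kk [z Sz kzE]] : [set k%:Z + z | k in K S & z in S_minus_K S]%classic (n x).
  apply: Hng; exists m => //; split=> //= m0.
  by have := system_gt0 Hn x; rewrite -mx m0.
exists (frobenius S - k%:Z); split; last first.
  move=> f Pf; have [nf _] := Pf; have fF := le_frobenius nf.
  have -> : n x + (frobenius S - k%:Z) - f = z + `|frobenius S - f|%N%:Z by lia.
  apply: Sz => /=; rewrite /K /=.
  by rewrite (_ : _ - _ = f); last by lia.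
(* If [frobenius S - k + s] were a gap, [k - s] would be in [K S], and irreducibility of
   [n x = s + (z + (k - s))] would force [z = 0]. Then [K S] is contained in [S], which makes [S]
   almost symmetric. *)
split=> // s [Ss /= s0]; apply: contrapT => nFks.
have ks := le_frobenius nFks.
have Kks : K S (k - s)%N.
  by rewrite /K /=; rewrite (_ : _ - _ = frobenius S - k%:Z + s%:Z); last by lia.
have Szks := Sz _ Kks.
have SsZ : toZ S s%:Z by rewrite toZE.
have nxE : n x = s%:Z + (z + (k - s)%N%:Z) by lia.
have [|zks0] := system_irr Hn SsZ Szks nxE; first by lia.
have K0 : K S 0%N by rewrite /K /= subr0.
have z_ge0 : 0 <= z by have := toZ_ge0 (Sz _ K0); rewrite addr0.
apply: Hnas => _ [k' Kk' [m' [Sm' /= m'0] <-]]; split; last by rewrite /=; lia.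
have Sk' : S k'.
  by have := Sz _ Kk'; rewrite (_ : z = 0) ?add0r ?toZE //; lia.
by case: HS => -[_ SD] _; apply: SD.
Qed.

(** A pseudo-Frobenius [f] lies above the gap [frobenius S - k]. With [m = n x + w], the sum [k + m]
    splits into [n x + frobenius S - f], [f - (frobenius S - k)] and [w], all in [S]. *)
Lemma almost_symmetric_of_frobenius (I : Type) (n phi : I -> int) :
  minimal_system S n -> ng_vector S n phi -> (forall x, phi x = frobenius S) ->
  almost_symmetric S.
Proof.
move=> Hn [_ Hphi] phiF _ [k Kk [m [Sm /= m0] <-]]; split; last by rewrite /=; lia.
have SmZ : toZ S m%:Z by rewrite toZE.
have [m0'|[x [w [Sw mE]]]] := system_gen Hn SmZ; first by lia.
have [f Pf Sf] := PF_above Kk.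
rewrite -toZE; have := Hphi x f Pf; rewrite phiF => Sx.
rewrite (_ : (k + m)%N%:Z =
  n x + frobenius S - f + (f - (frobenius S - k%:Z)) + w); last by lia.
by do 2 apply: toZD => //.
Qed.

End NumericalSemigroup.

Local Open Scope classical_set_scope.

(** * Irreducibility of minimal generators *)

Lemma submonoid_smallest (A : set nat) : submonoid (smallest submonoid A).
Proof.
split=> [T [[]]//|x y Ax Ay T TA].
by case: (TA) => -[_ TD] _; apply: TD; [exact: Ax|exact: Ay].
Qed.

Lemma minimal_generator_not_generated (A S : set nat) a :
  minimal_generators A S -> A a -> ~ smallest submonoid (A `\ a) a.
Proof.
move=> [<- Amin] Aa Ba; suff /Amin BA : generates (A `\ a) (smallest submonoid A).
  by move: (Aa); rewrite -BA; [case=> _; apply|move=> x []].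
rewrite /generates eqEsubset; split.
  by apply: sub_smallest2r; [exact: submonoid_smallest|move=> x []].
apply: smallest_sub; first exact: submonoid_smallest.
move=> x Ax; have [->//|xa] := eqVneq x a.
by apply: sub_gen_smallest; split=> //=; exact/eqP.
Qed.

(** Elements of [S] below [a] are generated without [a], so two nonzero summands would make [a]
    redundant. *)
Lemma minimal_generator_irreducible (A S : set nat) a x y :
  minimal_generators A S -> A a -> S x -> S y -> a = (x + y)%N ->
  x = 0%N \/ y = 0%N.
Proof.
move=> HA Aa; have [SE _] := HA => Sx Sy aE.
have sub z : S z -> (z < a)%N -> smallest submonoid (A `\ a) z.
  rewrite -SE => Sz za.
  (* The guard admits [a] to [T] vacuously and passes from a sum to its summands. *)
  pose T := [set z | (z < a)%N -> smallest submonoid (A `\ a) z].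
  suff : smallest submonoid A `<=` T by move=> /(_ z Sz za).
  have [B0 BD] := submonoid_smallest (A `\ a).
  apply: smallest_sub => [|u Au ua].
    by split=> // u v Tu Tv uv; apply: BD; [apply: Tu|apply: Tv]; lia.
  by apply: sub_gen_smallest; split=> //= uE; rewrite uE ltnn in ua.
have [->|x0] := eqVneq x 0%N; first by left.
have [->|y0] := eqVneq y 0%N; first by right.
case: (minimal_generator_not_generated HA Aa).
rewrite {2}aE; have [_ BD] := submonoid_smallest (A `\ a).
by apply: BD; apply: sub => //; lia.
Qed.

Lemma exists_minimal_system (S : set nat) m : n_generated m S ->
  exists n : 'I_m -> int, minimal_system S n.
Proof.
case=> A HA; rewrite card_eq_sym => /card_set_bijP[h [hA _ hsurj]].
have [SE _] := HA.
have AS : A `<=` S by rewrite -SE; exact: sub_gen_smallest.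
have hAo (x : 'I_m) : A (h x) by apply: hA => /=.
exists (fun x => (h x)%:Z); split.
- by move=> x; rewrite toZE; apply: AS.
- move=> x; suff : h x != 0%N by lia.
  apply/eqP => h0; case: (minimal_generator_not_generated HA (hAo x)).
  by rewrite {2}h0; case: (submonoid_smallest (A `\ h x)).
- move=> _ [v Sv <-].
  (* Membership in [S] is carried along so that the remainder [w + v'] stays in [S]. *)
  pose T := [set v | S v /\ (v = 0%N \/ exists (x : 'I_m) w, S w /\ v = (h x + w)%N)].
  have [S0 SD] : submonoid S by rewrite -SE; exact: submonoid_smallest.
  have : S `<=` T.
    rewrite -{1}SE; apply: smallest_sub.
      split=> [|u v' [Su uE] [Sv' v'E]]; first by split=> //; left.
      split; first exact: SD.
      case: uE => [->|[x [w [Sw ->]]]]; first by rewrite add0n.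
      by right; exists x, (w + v')%N; rewrite addnA; split=> //; apply: SD.
    move=> u Au; split; first exact: AS.
    have [x xm <-] := hsurj _ Au.
    by right; exists (Ordinal xm), 0%N; rewrite addn0.
  move=> /(_ v Sv)[_ [->|[x [w [Sw ->]]]]]; first by left.
  by right; exists x, w%:Z; rewrite toZE; split=> //; lia.
- move=> x _ _ [a Sa <-] [b Sb <-] hE.
  have hE' : h x = (a + b)%N by lia.
  by case: (minimal_generator_irreducible HA (hAo x) Sa Sb hE') => ->; [left|right].
Qed.

Local Close Scope classical_set_scope.
Local Close Scope ring_scope.

Theorem theorem2p10 (S : set nat)
  (HS : numerical_semigroup S) (Hgen : n_generated 5 S)
  (Hng : nearly_gorenstein S) (Hnas : ~ almost_symmetric S) :
  semigroup_type S <= 40.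
Proof.
have [n Hn] := exists_minimal_system Hgen.
have [phi Hphi] := exists_ng_vector HS Hn Hng Hnas.
have [x xF] : exists x, phi x <> frobenius S.
  apply: contrapT => nex; apply: Hnas.
  apply: (almost_symmetric_of_frobenius HS Hn Hphi) => x.
  by apply: contrapT => xF; apply: nex; exists x.
have [i [k [iF kF gik]]] := exists_twin HS Hn Hphi xF.
exact: (type_le40_of_twins HS Hn Hphi iF kF gik).
Qed.
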